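(* Let $R$ be a complete local domain possessing an operation $\natural$ that satisfies axioms (1), (3), (4), and (7) listed in the context. Let $x_1,\ldots,x_{k+1}$ be a partial system of parameters in $R$. Then $$(x_1,\ldots,x_k):_R x_{k+1}\subseteq (x_1,\ldots,x_k)^\natural_R.$$
   Context: Local rings are Noetherian. A partial system of parameters is a sequence that forms part of a system of parameters of $R$. An operation $\natural$ assigns to every pair $N\subseteq M$ of finitely generated $R$-modules a subset $N^\natural_M$ of $M$. The axioms, for all finitely generated $R$-modules $N$, $M$, $W$ with $N\subseteq M$, are: (1) $N^\natural_M$ is a submodule of $M$ containing $N$. (3) If $N\subseteq M\subseteq W$, then $N^\natural_W\subseteq M^\natural_W$. (4) If $f:M\to W$ is an $R$-module homomorphism, then $f(N^\natural_M)\subseteq f(N)^\natural_W$. (7) If $x_1,\ldots,x_{k+1}$ is a partial system of parameters for $R$, $J=(x_1,\ldots,x_k)$, $f:M\to R/J$ is a surjective homomorphism, and $v\in M$ satisfies $f(v)=x_{k+1}+J$, then $(Rv)^\natural_M\cap\ker f\subseteq (Jv)^\natural_M$. *)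

(* Defs.v *)
From HB Require Import structures.
From mathcomp Require Import all_boot all_order all_algebra.
From mathcomp Require Import boolp classical_sets.

Set Implicit Arguments.
Unset Strict Implicit.
Unset Printing Implicit Defensive.

Import GRing.Theory.

Local Open Scope classical_set_scope.
Local Open Scope ring_scope.
Local Open Scope quotient_scope.

Section Submodules.
Context {R : comNzRingType}.
Implicit Type V : lmodType R.

Definition submodule V (N : set V) : Prop := submod_closed [in N].

Definition span V (S : set V) : set V := smallest (@submodule V) S.

Definition fg V (N : set V) : Prop := exists s : seq V, N = span [set` s].

(* The set {a v : a in I}; it is the submodule Rv when I is the whole ring. *)
Definition scale_set V (I : set R) (v : V) : set V := [set a *: v | a in I].

End Submodules.

(* The quotient module V / span S. *)
Section QuotientModule.
Context {R : comNzRingType} {V : lmodType R} (S : set V).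

Definition in_span : {pred V} := fun v => `[< span S v >].

Lemma in_span_submod_closed : submod_closed in_span.
Proof.
split=> [|a u v /asboolP Su /asboolP Sv].
  by apply/asboolP => N [[N0 _] _]; rewrite /in_mem /= in N0; move/asboolP: N0.
apply/asboolP => N /[dup] -[[_ Nlin] _] NS.
have /set_mem := Nlin a u v (mem_set (Su N NS)) (mem_set (Sv N NS)).
exact.
Qed.

HB.instance Definition _ :=
  GRing.isSubmodClosed.Build R V in_span in_span_submod_closed.

Definition quot_span := (Quotient.quot in_span).

HB.instance Definition _ := GRing.Zmodule.on quot_span.
HB.instance Definition _ := EqQuotient.on quot_span.

Definition quot_pi (v : V) : quot_span := \pi_(Quotient.quot in_span) v.

Lemma quot_piP u v : quot_pi u = quot_pi v <-> span S (u - v).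
Proof.
split=> [/eqP|uv]; first by rewrite -Quotient.idealrBE => /asboolP.
by apply/eqP; rewrite -Quotient.idealrBE; apply/asboolP.
Qed.

Lemma quot_piK (q : quot_span) : quot_pi (repr q) = q.
Proof. exact: reprK. Qed.

Lemma quot_piD u v : quot_pi (u + v) = quot_pi u + quot_pi v.
Proof. exact: (raddfD \pi_(Quotient.quot in_span)). Qed.

Definition quot_scale (a : R) (q : quot_span) : quot_span :=
  quot_pi (a *: repr q).

Lemma quot_scale_pi a v : quot_scale a (quot_pi v) = quot_pi (a *: v).
Proof.
apply/quot_piP; rewrite -scalerBr; apply/asboolP.
suff: a *: (repr (quot_pi v) - v) \in in_span by [].
by apply: rpredZ; apply/asboolP/quot_piP; exact: quot_piK.
Qed.

Lemma quot_scaleA a b q :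
  quot_scale a (quot_scale b q) = quot_scale (a * b) q.
Proof. by rewrite -[q]quot_piK !quot_scale_pi scalerA. Qed.

Lemma quot_scale1 : left_id 1 quot_scale.
Proof. by move=> q; rewrite -[q]quot_piK quot_scale_pi scale1r. Qed.

Lemma quot_scaleDr : right_distributive quot_scale +%R.
Proof.
move=> a p q; rewrite -[p]quot_piK -[q]quot_piK.
by rewrite -quot_piD !quot_scale_pi scalerDr quot_piD.
Qed.

Lemma quot_scaleDl q : {morph quot_scale^~ q : a b / a + b}.
Proof.
by move=> a b; rewrite -[q]quot_piK !quot_scale_pi scalerDl quot_piD.
Qed.

HB.instance Definition _ := GRing.Zmodule_isLmodule.Build R quot_span
  quot_scaleA quot_scale1 quot_scaleDr quot_scaleDl.

Lemma quot_pi_is_linear : linear quot_pi.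
Proof. by move=> a u v; rewrite quot_piD -quot_scale_pi. Qed.

HB.instance Definition _ :=
  GRing.isLinear.Build R V quot_span *:%R quot_pi quot_pi_is_linear.

End QuotientModule.

Section LocalRings.
Context {R : comNzRingType}.
Implicit Types (I P m : set R) (s : seq R).

(* Ideals of R are the submodules of the regular module R^o. *)
Definition ideal I : Prop := submodule (I : set R^o).

Definition ideal_gen s : set R := span ([set` s] : set R^o).

Definition noetherian : Prop := forall I, ideal I -> fg (I : set R^o).

Definition maximal_ideal m : Prop :=
  [/\ ideal m, m <> setT &
      forall I, ideal I -> m `<=` I -> I = m \/ I = setT].

Definition prime_ideal P : Prop :=
  [/\ ideal P, P <> setT & forall a b, P (a * b) -> P a \/ P b].

Definition local_ring m : Prop :=
  [/\ noetherian, maximal_ideal m & forall m', maximal_ideal m' -> m' = m].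

Definition radical I : set R := [set a | exists n, I (a ^+ n)].

Definition colon I (b : R) : set R := [set a | I (a * b)].

Fixpoint ideal_exp I (n : nat) : set R :=
  if n is n'.+1
  then span ([set a * b | a in I & b in ideal_exp I n'] : set R^o)
  else setT.

Definition adic_lim I (u : nat -> R) (l : R) : Prop :=
  forall n, exists N, forall i, (N <= i)%N -> ideal_exp I n (u i - l).

Definition adic_cauchy I (u : nat -> R) : Prop :=
  forall n, exists N, forall i j, (N <= i)%N -> (N <= j)%N ->
    ideal_exp I n (u i - u j).

Definition adic_complete I : Prop :=
  \bigcap_n ideal_exp I n = [set 0] /\
  forall u, adic_cauchy I u -> exists l, adic_lim I u l.

(* P 0, ..., P n is a strictly increasing chain of primes, of length n. *)
Definition prime_chain (n : nat) (P : nat -> set R) : Prop :=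
  (forall i, (i <= n)%N -> prime_ideal (P i)) /\
  (forall i, (i < n)%N -> P i `<` P i.+1).

Definition krull_dim (d : nat) : Prop :=
  (exists P : nat -> set R, prime_chain d P) /\
  (forall n (P : nat -> set R), prime_chain n P -> (n <= d)%N).

(* dim R elements generating an ideal primary to the maximal ideal m, i.e.
   with radical m. *)
Definition sop m s : Prop :=
  krull_dim (size s) /\ radical (ideal_gen s) = m.

(* The remaining elements can be put last: sop is invariant under
   permutation. *)
Definition partial_sop m s : Prop := exists t, sop m (s ++ t).

End LocalRings.

Arguments noetherian R : clear implicits.
Arguments krull_dim R d : clear implicits.

Section Operations.
Context {R : comNzRingType}.

(* op M N is meant for fg M and fg submodules N of M only; the axioms say
   nothing about its other values. *)
Definition module_op := forall M : lmodType R, set M -> set M.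

Definition fg_pair (M : lmodType R) (N : set M) : Prop :=
  [/\ fg [set: M], submodule N & fg N].

Variable op : module_op.

Definition op_submodule : Prop := forall (M : lmodType R) (N : set M),
  fg_pair N -> submodule (op N) /\ N `<=` op N.

Definition op_monotone : Prop := forall (W : lmodType R) (N M : set W),
  fg_pair N -> fg_pair M -> N `<=` M -> op N `<=` op M.

Definition op_functorial : Prop :=
  forall (M W : lmodType R) (N : set M) (f : {linear M -> W}),
  fg_pair N -> fg [set: W] -> f @` op N `<=` op (f @` N).

Definition op_sop (m : set R) : Prop :=
  forall (s : seq R) (y : R), partial_sop m (rcons s y) ->
  forall (M : lmodType R) (f : {linear M -> quot_span ([set` s] : set R^o)})
    (v : M),
  fg [set: M] -> range f = setT -> f v = quot_pi _ (y : R^o) ->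
  op (scale_set setT v) `&` f @^-1` [set 0] `<=` op (scale_set (ideal_gen s) v).

End Operations.

Arguments module_op R : clear implicits.

(* Main.v *)
(** Write J = (s).  Apply axiom (7) not to R -> R/J but to
    f : R (+) R -> R/J, f(a, b) = a + b y + J, with v = (0, 1): the extra
    summand makes f surjective, while R v is a copy of R inside the source.
    If a y lies in J, then a v lies in R v and in ker f, hence in (J v)^op,
    and the second projection sends a v to a and J v to J. *)

Require Import Defs.
From HB Require Import structures.
From mathcomp Require Import all_boot all_order all_algebra.
From mathcomp Require Import boolp classical_sets.

Local Open Scope classical_set_scope.
Local Open Scope ring_scope.

Import GRing.Theory.

Section Submodules.
Set Implicit Arguments.
Unset Strict Implicit.
Local Notation span := Defs.span.
Context {R : comNzRingType}.
Implicit Types V W : lmodType R.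

(** Trades the boolean membership built into [submod_closed] for plain propositions, the form in
    which every closure argument below is carried out. *)
Lemma submoduleP V (N : set V) :
  submodule N <-> N 0 /\ forall a u v, N u -> N v -> N (a *: u + v).
Proof.
split=> [[N0 Nlin]|[N0 Nlin]].
  split=> [|a u v Nu Nv]; first exact: set_mem.
  by apply/set_mem/Nlin; apply/mem_set.
by split=> [|a u v /set_mem Nu /set_mem Nv]; apply/mem_set; [|exact: Nlin].
Qed.

Lemma sub_span V (S : set V) : S `<=` span S.
Proof. exact: sub_smallest. Qed.

Lemma span_min V (S N : set V) : submodule N -> S `<=` N -> span S `<=` N.
Proof. exact: smallest_sub. Qed.

Lemma span_submodule V (S : set V) : submodule (span S).
Proof.
apply/submoduleP; split=> [N [/submoduleP[N0 _] _] //|a u v Su Sv N NS].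
by have /submoduleP[_] := NS.1; apply; [exact: Su | exact: Sv].
Qed.

Lemma submodule_image V W (f : V -> W) (N : set V) :
  linear f -> submodule N -> submodule (f @` N).
Proof.
move=> flin /submoduleP[N0 Nlin]; apply/submoduleP; split.
  (* Here [f] is a bare function; linearity with coefficient -1 at 0 gives
     [f 0 = - f 0 + f 0 = 0]. *)
  by exists 0 => //; have := flin (-1) 0 0; rewrite !scaleN1r !addNr.
by move=> a _ _ [u Nu <-] [v Nv <-]; exists (a *: u + v); [exact: Nlin | exact: flin].
Qed.

Lemma submodule_preimage V W (f : V -> W) (N : set W) :
  linear f -> submodule N -> submodule (f @^-1` N).
Proof.
move=> flin /submoduleP[N0 Nlin]; apply/submoduleP; split.
  have := flin (-1) 0 0; rewrite !scaleN1r !addNr => f00.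
  by rewrite /preimage /= f00.
by move=> a u v Nu Nv; rewrite /preimage /= flin; exact: Nlin.
Qed.

(** Both inclusions follow from minimality of a span: the preimage of [span (f @]
    S)[is a submodule containing]S[, and the image of]span S[is one containing]f @[S]. *)
Lemma span_image V W (f : V -> W) (S : set V) :
  linear f -> f @` span S = span (f @` S).
Proof.
move=> flin; apply/seteqP; split=> [_ [u Su <-]|].
  have /(_ u Su) : span S `<=` f @^-1` span (f @` S).
    apply: span_min; first exact/submodule_preimage/span_submodule.
    by move=> x Sx; apply: sub_span; exists x.
  by [].
apply: span_min; first exact/submodule_image/span_submodule.
by move=> _ [u Su <-]; exists u => //; exact: sub_span.
Qed.

Lemma fg_image V W (f : V -> W) (N : set V) :
  linear f -> fg N -> fg (f @` N).
Proof.
move=> flin [s ->]; exists (map f s); rewrite span_image //; congr span.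
apply/seteqP; split=> [_ [u us <-]|x /= /mapP[u us ->]]; last by exists u.
by apply/mapP; exists u.
Qed.

Lemma setT_submodule V : submodule [set: V].
Proof. exact/submoduleP. Qed.

Lemma fg_regular : fg [set: R^o].
Proof.
exists [:: 1]; apply/seteqP; split=> // a _.
have /submoduleP[z lin] := @span_submodule R^o [set` [:: 1 : R^o]].
have := lin a 1 0; rewrite addr0 [a *: 1]mulr1; apply=> //.
by apply: sub_span; rewrite /= mem_head.
Qed.

Lemma fg_regular2 : fg [set: (R^o * R^o)%type].
Proof.
pose e1 : R^o * R^o := (1, 0); pose e2 : R^o * R^o := (0, 1).
exists [:: e1; e2]; apply/seteqP; split=> // -[a b] _.
have /submoduleP[z lin] := span_submodule [set` [:: e1; e2]].
(* The final [+ 0] lets the closure property, stated for [a *: u + v], be applied twice. *)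
have -> : (a, b) = a *: e1 + (b *: e2 + 0).
  by congr pair; rewrite /= !(addr0, add0r, scaler0) /GRing.scale /= mulr1.
apply: (lin); last apply: lin => //; apply: sub_span.
- by rewrite /= mem_head.
- by rewrite /= !inE eqxx orbT.
Qed.

(** Makes [scale_set I v] the image of the ideal [I] under a linear map, so that it inherits from
    [I] being a finitely generated submodule. *)
Lemma scale_linear V (v : V) : linear (fun a : R^o => a *: v).
Proof. by move=> a b c; rewrite scalerDl scalerA. Qed.

Lemma fg_pair_scale_set V (I : set R) (v : V) :
  fg [set: V] -> ideal I -> fg (I : set R^o) -> fg_pair (scale_set I v).
Proof.
move=> fgV idI fgI; split=> //.
- exact: (@submodule_image R^o V _ I (scale_linear v)).
- exact: (@fg_image R^o V _ I (scale_linear v)).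
Qed.

Lemma ideal_gen_ideal (s : seq R) : ideal (ideal_gen s).
Proof. exact: span_submodule. Qed.

End Submodules.

Theorem proposition1p4 (R : idomainType) (m : set R) (op : module_op R)
    (s : seq R) (y : R) :
  local_ring m -> adic_complete m ->
  op_submodule op -> op_monotone op -> op_functorial op -> op_sop op m ->
  partial_sop m (rcons s y) ->
  colon (ideal_gen s) y `<=` op R^o (ideal_gen s).
Proof.
move=> _ _ op1 _ op4 op7 sop_sy a ay.
pose M : lmodType R := (R^o * R^o)%type.
pose v : M := (0, 1).
pose pi := quot_pi ([set` s] : set R^o).
pose f0 (u : M) := pi (u.1 + u.2 * y).
have f0_lin : linear f0.
  move=> c u w; rewrite /f0 -[RHS]linearP; congr pi.
  by rewrite /= scalerDr mulrDl addrACA -!scalerAl.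
pose fL := GRing.isLinear.Build _ _ _ _ f0 f0_lin.
pose f : {linear M -> quot_span ([set` s] : set R^o)} := HB.pack f0 fL.
have snd_scale (I : set R) : snd @` scale_set I v = I.
  apply/seteqP; split=> [_ [_ [b Ib <-] <-]|b Ib].
    by rewrite /= [b *: _]mulr1.
  by exists (b *: v); [exists b | rewrite /= [b *: _]mulr1].
have fgR : fg_pair (scale_set setT v).
  apply: fg_pair_scale_set; first exact: fg_regular2.
  - exact: setT_submodule.
  - exact: fg_regular.
have fgJ : fg_pair (scale_set (ideal_gen s) v).
  apply: fg_pair_scale_set; first exact: fg_regular2.
  - exact: ideal_gen_ideal.
  - by exists s.
have av : op M (scale_set (ideal_gen s) v) (a *: v).
  apply: (op7 s y sop_sy M f v fg_regular2).
  (* Surjectivity comes from the first summand alone: [f] restricted to it is the quotient map. *)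
  - apply/seteqP; split=> // q _; exists (repr q : R^o, 0) => //.
    by rewrite /= /f0 /= mul0r addr0 /pi quot_piK.
  - by rewrite /= /f0 /= mul1r add0r.
  (* By axiom (1), [a *: v] lies in [op] of the submodule generated by [v]. For the kernel,
     [f (a *: v)] is the class of [a * y], which is zero by [ay]. *)
  - split; first by apply: (op1 _ _ fgR).2; exists a.
    rewrite /preimage /= /f0 /= scaler0 add0r [a *: 1]mulr1.
    rewrite -(linear0 (quot_pi ([set` s] : set R^o))).
    by apply/quot_piP; rewrite subr0.
have := op4 M R^o _ (snd : {linear M -> R^o}) fgJ fg_regular.
rewrite snd_scale; apply.
by exists (a *: v); rewrite //= [a *: _]mulr1.
Qed.
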